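(* Let $F$ be a formal group over $\mathbb{C}$ with $\log F=f$. Then for any $p(x)\in \mathbb{C}((x))$, $$\psi_{p(x)}(x,z)=e^{f(z)p(x)\frac{d}{dx}}x=\sum_{n\ge 0}\frac{f(z)^{n}}{n!}\left(p(x)\frac{d}{dx}\right)^{n}x$$ is an associate of $F$. Furthermore, every associate of $F$ is of this form.
   Context: A (one-dimensional) formal group over $\mathbb{C}$ is a formal power series $F(x,y)\in\mathbb{C}[[x,y]]$ with $F(x,0)=x$, $F(0,y)=y$, $F(x,F(y,z))=F(F(x,y),z)$. Its logarithm $\log F$ is the unique $f(x)\in\mathbb{C}[[x]]$ with $f(0)=0$, $f'(0)=1$ and $f(F(x,y))=f(x)+f(y)$. An associate of $F$ is a formal series $\phi(x,z)\in\mathbb{C}((x))[[z]]$ satisfying $\phi(x,0)=x$ and $\phi(\phi(x,y),z)=\phi(x,F(y,z))$. Here, in substituting $\phi(x,y)$ for the first variable, $\phi(x,y)^m$ ($m\in\mathbb{Z}$) is taken in $\mathbb{C}((x))[[y]]$, where $\phi(x,y)$ is a unit since $\phi(x,0)=x$. *)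

(* Defs.v *)
From HB Require Import structures.
From mathcomp Require Import all_boot all_order all_algebra.
From mathcomp Require Import boolp classical_sets functions cardinality fsbigop.
From mathcomp Require Import reals.
From mathcomp Require Import complex.
From mathcomp Require Import zify.

Set Implicit Arguments.
Unset Strict Implicit.
Unset Printing Implicit Defensive.

Import Order.TTheory GRing.Theory Num.Theory.
Local Open Scope classical_set_scope.
Local Open Scope ring_scope.

(******************************************************************************)
(*          fps A == A[[t]]; f n is the coefficient of t^n                    *)
(*      laurent A == A((t)); f i is the coefficient of t^i, i : int           *)
(* Series in several variables are iterated:                                  *)
(*   F : fps (fps K)            F(x,y) = \sum_(i, j) F i j x^i y^j            *)
(*   G : fps (fps (fps K))      G(x,y,z) = \sum_(i, j, k) G i j k x^i y^j z^k *)
(*   phi : fps (laurent K)      phi(x,z) = \sum_(n, j) phi n j x^j z^n        *)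
(* Infinite sums of scalars are taken coefficientwise, with the               *)
(* finite-support sum \sum_(m \in setT) of fsbigop. That operator is 0 by     *)
(* convention on an infinite support; the lemmas *_finite show that this      *)
(* convention is never used here.                                             *)
(******************************************************************************)

Record fps (A : Type) := Fps { fcoef :> nat -> A }.

Lemma fpsP (A : Type) (f g : fps A) : (forall n, f n = g n) <-> f = g.
Proof.
split=> [fg|->//]; case: f g fg => f [g] /= fg.
by congr Fps; apply: funext.
Qed.

HB.instance Definition _ (A : Type) := gen_eqMixin (fps A).
HB.instance Definition _ (A : Type) := gen_choiceMixin (fps A).

Section FpsRing.
Variable A : comNzRingType.
Implicit Types f g h : fps A.

Definition fzero : fps A := Fps (fun=> 0).
Definition fopp f : fps A := Fps (fun n => - f n).
Definition fadd f g : fps A := Fps (fun n => f n + g n).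
Definition fC (a : A) : fps A := Fps (fun n => if n == 0%N then a else 0).
Definition fmul f g : fps A :=
  Fps (fun n => \sum_(i < n.+1) f i * g (n - i)%N).

Fact faddA : associative fadd.
Proof. by move=> f g h; apply/fpsP => n /=; rewrite addrA. Qed.
Fact faddC : commutative fadd.
Proof. by move=> f g; apply/fpsP => n /=; rewrite addrC. Qed.
Fact fadd0 : left_id fzero fadd.
Proof. by move=> f; apply/fpsP => n /=; rewrite add0r. Qed.
Fact faddN : left_inverse fzero fopp fadd.
Proof. by move=> f; apply/fpsP => n /=; rewrite addNr. Qed.
HB.instance Definition _ :=
  GRing.isZmodule.Build (fps A) faddA faddC fadd0 faddN.

Definition ftrunc n f : {poly A} := \poly_(i < n.+1) f i.

Fact coef_ftrunc n f i : (i <= n)%N -> (ftrunc n f)`_i = f i.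
Proof. by move=> lein; rewrite coef_poly ltnS lein. Qed.

Fact fmul_trunc n f g (p q : {poly A}) :
  (forall i, (i <= n)%N -> p`_i = f i) ->
  (forall i, (i <= n)%N -> q`_i = g i) ->
  forall i, (i <= n)%N -> (p * q)`_i = fmul f g i.
Proof.
move=> pf qg i lein; rewrite coefM /=; apply: eq_bigr => j _.
by rewrite pf ?qg //; have := ltn_ord j; lia.
Qed.

Fact fmulA : associative fmul.
Proof.
move=> f g h; apply/fpsP => n.
rewrite -(@fmul_trunc n f (fmul g h) (ftrunc n f) (ftrunc n g * ftrunc n h)) //.
- rewrite -(@fmul_trunc n (fmul f g) h (ftrunc n f * ftrunc n g) (ftrunc n h)) //.
  + by rewrite mulrA.
  + by apply: fmul_trunc => i; apply: coef_ftrunc.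
  + by move=> i; apply: coef_ftrunc.
- by move=> i; apply: coef_ftrunc.
- by apply: fmul_trunc => i; apply: coef_ftrunc.
Qed.

Fact fmulC : commutative fmul.
Proof.
move=> f g; apply/fpsP => n; pose tr := ftrunc n.
rewrite -(@fmul_trunc n f g (tr f) (tr g)) //; try exact: coef_ftrunc.
rewrite -(@fmul_trunc n g f (tr g) (tr f)) //; try exact: coef_ftrunc.
by rewrite mulrC.
Qed.

Fact fmul1 : left_id (fC 1) fmul.
Proof.
move=> f; apply/fpsP => n /=; rewrite big_ord_recl /= mul1r subn0 big1 ?addr0 //.
by move=> i _; rewrite mul0r.
Qed.

Fact fmulDl : left_distributive fmul +%R.
Proof.
move=> f g h; apply/fpsP => n /=.
by rewrite -big_split; apply: eq_bigr => i _ /=; rewrite mulrDl.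
Qed.

Fact fone_neq0 : fC 1 != 0.
Proof. by apply/eqP => /fpsP/(_ 0%N)/= /eqP; rewrite oner_eq0. Qed.

HB.instance Definition _ := GRing.Zmodule_isComNzRing.Build (fps A)
  fmulA fmulC fmul1 fmulDl fone_neq0.

Definition funit : {pred fps A} := [pred f | `[< exists g, g * f = 1 >]].
Definition finv f : fps A :=
  if pselect (exists g, g * f = 1) is left e then projT1 (cid e) else f.

Fact fmulV : {in funit, left_inverse 1 finv *%R}.
Proof.
move=> f /asboolP e; rewrite /finv; case: pselect => // e'.
by case: cid => g.
Qed.
Fact funitPl f g : g * f = 1 -> funit f.
Proof. by move=> gf1; apply/asboolP; exists g. Qed.
Fact finv_out : {in [predC funit], finv =1 id}.
Proof. by move=> f /asboolP e; rewrite /finv; case: pselect. Qed.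
HB.instance Definition _ := GRing.ComNzRing_hasMulInverse.Build (fps A)
  fmulV funitPl finv_out.

Definition fX : fps A := Fps (fun n => (n == 1%N)%:R).

Definition fderiv f : fps A := Fps (fun n => f n.+1 *+ n.+1).

Lemma fcoefM f g n : (f * g) n = \sum_(i < n.+1) f i * g (n - i)%N.
Proof. by []. Qed.

Lemma fcoef_sum I (r : seq I) (P : pred I) (F : I -> fps A) n :
  (\sum_(i <- r | P i) F i) n = \sum_(i <- r | P i) F i n.
Proof. by elim/big_rec2: _ => //= i y1 y2 _ <-. Qed.

Lemma fexp_small f m n : f 0%N = 0 -> (n < m)%N -> (f ^+ m) n = 0.
Proof.
move=> f0; elim: m n => // m IHm n ltnm.
rewrite exprS fcoefM big1 // => -[[|i] /= lti] _; first by rewrite f0 mul0r.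
by rewrite IHm ?mulr0 //; lia.
Qed.

Lemma fps_unitP f : reflect (exists b, b * f 0%N = 1) (f \is a GRing.unit).
Proof.
apply: (iffP idP) => [/mulVr/fpsP/(_ 0%N)|[b bf]].
  by rewrite fcoefM big_ord1 => e; exists (f^-1 0%N).
pose h := 1 - fC b * f; have h0 : h 0%N = 0.
  by rewrite /h /= big_ord1 /= bf subrr.
pose g : fps A := Fps (fun n => (\sum_(i < n.+1) h ^+ i) n).
suff g1 : g * (1 - h) = 1.
  have : (g * fC b) * f = 1 by rewrite -mulrA -[RHS]g1 /h opprB addrC subrK.
  by move/funitPl.
have gE n m : (m <= n)%N -> (\sum_(i < n.+1) h ^+ i) m = g m.
  move=> lemn; rewrite -(subnKC lemn); elim: (n - m)%N => [|d IHd].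
    by rewrite addn0.
  rewrite addnS big_ord_recr /= [X in X = _](_ : _ =
    (\sum_(i < (m + d).+1) h ^+ i) m + (h ^+ (m + d).+1) m) //.
  by rewrite IHd fexp_small ?addr0 //; lia.
apply/fpsP => n.
have -> : (g * (1 - h)) n = ((\sum_(i < n.+1) h ^+ i) * (1 - h)) n.
  by rewrite !fcoefM; apply: eq_bigr => i _; rewrite gE //; have := ltn_ord i; lia.
rewrite mulrC -[1 - h]opprB mulNr -subrX1 opprB.
by rewrite [LHS](_ : _ = (1 : fps A) n - (h ^+ n.+1) n) // fexp_small // subr0.
Qed.

End FpsRing.

Arguments fX {A}.

Definition bounded_below (A : nmodType) (f : int -> A) :=
  exists N : int, forall i, i < N -> f i = 0.

Record laurent (A : nmodType) :=
  Laurent { lcoef :> int -> A; lcoefP : bounded_below lcoef }.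

Lemma laurentP (A : nmodType) (f g : laurent A) :
  (forall n, f n = g n) <-> f = g.
Proof.
split=> [fg|->//]; case: f g fg => f fP [g gP] /= fg.
have e : f = g by apply: funext.
by case: _ / e gP => gP; congr Laurent; apply: Prop_irrelevance.
Qed.

HB.instance Definition _ (A : nmodType) := gen_eqMixin (laurent A).
HB.instance Definition _ (A : nmodType) := gen_choiceMixin (laurent A).

Section LaurentRing.
Variable A : comNzRingType.
Implicit Types f g h : laurent A.

Fact lshift_subproof (N : int) (g : fps A) :
  bounded_below (fun i : int => if i < N then 0 else g `|i - N|%N).
Proof. by exists N => i ->. Qed.
(* t^N * g(t) *)
Definition lshift N (g : fps A) : laurent A := Laurent (lshift_subproof N g).

Lemma lshiftE f N : (forall i, i < N -> f i = 0) ->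
  f = lshift N (Fps (fun n => f (N + n%:Z))).
Proof.
move=> fN; apply/laurentP => i /=; case: ltP => [/fN//|leNi].
by congr (f _); lia.
Qed.

Fact lopp_subproof f : bounded_below (fun i => - f i).
Proof. by have [N fN] := lcoefP f; exists N => i /fN ->; rewrite oppr0. Qed.
Fact ladd_subproof f g : bounded_below (fun i => f i + g i).
Proof.
have [N fN] := lcoefP f; have [M gM] := lcoefP g.
exists (Num.min N M) => i; rewrite lt_min => /andP[/fN -> /gM ->].
by rewrite addr0.
Qed.

Definition lopp f : laurent A := Laurent (lopp_subproof f).
Definition ladd f g : laurent A := Laurent (ladd_subproof f g).
(* a t^N *)
Definition lmonom (a : A) (N : int) : laurent A := lshift N (fC a).

Fact laddA : associative ladd.
Proof. by move=> f g h; apply/laurentP => n /=; rewrite addrA. Qed.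
Fact laddC : commutative ladd.
Proof. by move=> f g; apply/laurentP => n /=; rewrite addrC. Qed.
Fact ladd0 : left_id (lshift 0 0) ladd.
Proof. by move=> f; apply/laurentP => n /=; case: ifP; rewrite add0r. Qed.
Fact laddN : left_inverse (lshift 0 0) lopp ladd.
Proof. by move=> f; apply/laurentP => n /=; case: ifP; rewrite addNr. Qed.
HB.instance Definition _ :=
  GRing.isZmodule.Build (laurent A) laddA laddC ladd0 laddN.

Lemma lcoef0 n : (0 : laurent A) n = 0.
Proof. by rewrite /= if_same. Qed.

Definition lmul_coef f g (n : int) : A :=
  \sum_(i \in [set: int]) f i * g (n - i).

Fact lmul_coef_small f g (N M n : int) :
  (forall i, i < N -> f i = 0) -> (forall i, i < M -> g i = 0) ->
  n < N + M -> lmul_coef f g n = 0.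
Proof.
move=> fN gM ltn; apply: fsbig1 => i _; case: (ltP i N) => [/fN ->|leNi].
  by rewrite mul0r.
by rewrite gM ?mulr0 //; lia.
Qed.

Fact lmul_coef_shift f g (N M : int) (k : nat) :
  (forall i, i < N -> f i = 0) -> (forall i, i < M -> g i = 0) ->
  lmul_coef f g (N + M + k%:Z) =
  \sum_(a < k.+1) f (N + a%:Z) * g (M + (k - a)%N%:Z).
Proof.
move=> fN gM; rewrite /lmul_coef.
pose s := [seq N + a%:Z | a <- index_iota 0 k.+1].
have us : uniq s by rewrite map_inj_uniq ?iota_uniq // => a b; lia.
rewrite -(@fsbig_widen _ _ 0 +%R [set` s]) //; last first.
  move=> i /= [_ iNs]; case: (ltP i N) => [/fN ->|leNi].
    by rewrite mul0r.
  case: (ltP (N + M + k%:Z - i) M) => [/gM ->|le2]; first by rewrite mulr0.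
  exfalso; apply: iNs; apply/mapP; exists `|i - N|%N; last by lia.
  by rewrite mem_index_iota; lia.
rewrite -fsbig_seq // big_map big_mkord; apply: eq_bigr => a _.
by congr (_ * g _); have := ltn_ord a; lia.
Qed.

Fact lmul_subproof f g : bounded_below (lmul_coef f g).
Proof.
have [N fN] := lcoefP f; have [M gM] := lcoefP g.
by exists (N + M) => n; apply: lmul_coef_small.
Qed.
Definition lmul f g : laurent A := Laurent (lmul_subproof f g).

Fact lmul_shift N M (f g : fps A) :
  lmul (lshift N f) (lshift M g) = lshift (N + M) (f * g).
Proof.
have lts (K : int) (h : fps A) i : i < K -> lshift K h i = 0 by move=> /= ->.
apply/laurentP => n /=; case: ltP => [|le].
  by apply: lmul_coef_small; apply: lts.
have -> : n = N + M + `|n - (N + M)%R|%N%:Z by lia.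
set k := `|n - (N + M)%R|%N.
rewrite lmul_coef_shift; [|exact: lts|exact: lts].
have -> : `|(N + M + k%:Z)%R - (N + M)%R|%N = k by lia.
apply: eq_bigr => a _ /=.
have -> : (N + a%:Z < N) = false by lia.
have -> : (M + (k - a)%N%:Z < M) = false by lia.
by congr (f _ * g _); lia.
Qed.

Fact ladd_shift N (f g : fps A) :
  lshift N f + lshift N g = lshift N (f + g).
Proof. by apply/laurentP => n /=; case: ifP => //; rewrite addr0. Qed.

Fact lshift_ind f : exists N (g : fps A), f = lshift N g.
Proof. by have [N /lshiftE ->] := lcoefP f; exists N; eexists. Qed.

Fact lshift_ind2 f g : exists N (f' g' : fps A), f = lshift N f' /\ g = lshift N g'.
Proof.
have [N fN] := lcoefP f; have [M gM] := lcoefP g.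
exists (Num.min N M); do 2 eexists; split; apply: lshiftE => i.
  by rewrite lt_min => /andP[/fN].
by rewrite lt_min => /andP[_ /gM].
Qed.

Fact lmulA : associative lmul.
Proof.
move=> f g h; have [N [f' ->]] := lshift_ind f.
have [M [g' ->]] := lshift_ind g; have [K [h' ->]] := lshift_ind h.
by rewrite !lmul_shift mulrA addrA.
Qed.
Fact lmulC : commutative lmul.
Proof.
move=> f g; have [N [f' ->]] := lshift_ind f.
by have [M [g' ->]] := lshift_ind g; rewrite !lmul_shift mulrC addrC.
Qed.
Fact lmul1 : left_id (lmonom 1 0) lmul.
Proof.
move=> f; have [N [f' ->]] := lshift_ind f.
by rewrite lmul_shift mul1r add0r.
Qed.
Fact lmulDl : left_distributive lmul +%R.
Proof.
move=> f g h; have [M [h' ->]] := lshift_ind h.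
have [N [f' [g' [-> ->]]]] := lshift_ind2 f g.
by rewrite ladd_shift !lmul_shift ladd_shift mulrDl.
Qed.
Fact lone_neq0 : lmonom 1 0 != 0.
Proof. by apply/eqP => /laurentP/(_ 0)/= /eqP; rewrite oner_eq0. Qed.

HB.instance Definition _ := GRing.Zmodule_isComNzRing.Build (laurent A)
  lmulA lmulC lmul1 lmulDl lone_neq0.

Lemma lcoefM f g n : (f * g) n = \sum_(i \in [set: int]) f i * g (n - i).
Proof. by []. Qed.

Lemma lmonomE a N i : lmonom a N i = if i == N then a else 0.
Proof.
rewrite /=; case: ltP => [|leNi]; first by move=> /lt_eqF ->.
by congr (if _ then _ else _); lia.
Qed.

Fact lscale_subproof a f : bounded_below (fun i => a * f i).
Proof. by have [N fN] := lcoefP f; exists N => i /fN ->; rewrite mulr0. Qed.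
Definition lscale a f : laurent A := Laurent (lscale_subproof a f).

Fact lscaleA a b f : lscale a (lscale b f) = lscale (a * b) f.
Proof. by apply/laurentP => n /=; rewrite mulrA. Qed.
Fact lscale1 : left_id 1 lscale.
Proof. by move=> f; apply/laurentP => n /=; rewrite mul1r. Qed.
Fact lscaleDr : right_distributive lscale +%R.
Proof. by move=> a f g; apply/laurentP => n /=; rewrite mulrDr. Qed.
Fact lscaleDl f : {morph lscale^~ f : a b / a + b}.
Proof. by move=> a b; apply/laurentP => n /=; rewrite mulrDl. Qed.
HB.instance Definition _ := GRing.Zmodule_isLmodule.Build A (laurent A)
  lscaleA lscale1 lscaleDr lscaleDl.

Definition lX : laurent A := lmonom 1 1.

Fact lderiv_subproof f : bounded_below (fun i : int => f (i + 1) *~ (i + 1)).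
Proof.
have [N fN] := lcoefP f; exists (N - 1) => i lti.
by rewrite fN ?mul0rz //; lia.
Qed.
Definition lderiv f : laurent A := Laurent (lderiv_subproof f).

End LaurentRing.

Arguments lX {A}.

Section FormalGroup.
Variable K : fieldType.
Implicit Types (f g : fps K) (F : fps (fps K)) (p : laurent K).
Implicit Types phi : fps (laurent K).

(* g(F(x,y)) = \sum_m g_m F(x,y)^m, for F without constant term. *)
Definition fsubst g F : fps (fps K) :=
  Fps (fun i => Fps (fun j => \sum_(m \in [set: nat]) g m * (F ^+ m) i j)).

(* f(x) and f(y) as elements of K[[x,y]] *)
Definition in_x f : fps (fps K) := Fps (fun i => fC (f i)).
Definition in_y f : fps (fps K) := fC f.

(* F(x,F(y,z)) = \sum_i x^i F_i(F(y,z)) where F(x,y) = \sum_i x^i F_i(y) *)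
Definition assoc_r F : fps (fps (fps K)) := Fps (fun i => fsubst (F i) F).

(* F(F(x,y),z) = \sum_k G_k(F(x,y)) z^k where F(x,z) = \sum_k G_k(x) z^k *)
Definition assoc_l F : fps (fps (fps K)) :=
  Fps (fun i => Fps (fun j => Fps (fun k =>
    fsubst (Fps (fun m => F m k)) F i j))).

Definition formal_group F : Prop :=
  [/\ Fps (fun i => F i 0%N) = fX,
      F 0%N = fX
    & assoc_r F = assoc_l F].

Definition is_log F f : Prop :=
  [/\ f 0%N = 0, fderiv f 0%N = 1 & fsubst f F = in_x f + in_y f].

(* Coefficient of x^j y^k in p(phi(x,y)) = \sum_(m : int) p_m phi(x,y)^m; the
   powers phi ^ m are those of the ring K((x))[[y]] = fps (laurent K), in which
   phi is a unit as soon as phi(x,0) = x: lemma phi_unit. *)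
Definition lsubst_coef p phi (k : nat) (j : int) : K :=
  \sum_(m \in [set: int]) p m * (phi ^ m) k j.

(* Coefficient of x^j y^k z^n in phi(phi(x,y),z). *)
Definition iterate_coef phi (n k : nat) (j : int) : K :=
  lsubst_coef (phi n) phi k j.

(* Coefficient of x^j y^k z^n in phi(x,F(y,z)) = \sum_m phi_m(x) F(y,z)^m. *)
Definition compose_coef phi F (n k : nat) (j : int) : K :=
  fsubst (Fps (fun m => phi m j)) F k n.

Definition associate F phi : Prop :=
  phi 0%N = lX /\
  forall (n k : nat) (j : int), iterate_coef phi n k j = compose_coef phi F n k j.

(* p(x) d/dx *)
Definition derivation p (g : laurent K) : laurent K := p * lderiv g.

(* \sum_n f(z)^n / n! (p(x) d/dx)^n x, as a series in z over K((x)) *)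
Definition psi f p : fps (laurent K) :=
  Fps (fun k => \sum_(n \in [set: nat])
    ((f ^+ n) k / n`!%:R) *: iter n (derivation p) lX).

Lemma finite_set_le (P : set nat) B : (forall m, P m -> (m <= B)%N) -> finite_set P.
Proof.
move=> PB; apply: (@sub_finite_set _ _ `I_B.+1); last exact: finite_II.
by move=> m /PB.
Qed.

Lemma fexp2_small F m i j : F 0%N 0%N = 0 -> (i + j < m)%N -> (F ^+ m) i j = 0.
Proof.
move=> F0; elim: m i j => // m IHm i j ltm.
rewrite exprS fcoefM fcoef_sum big1 // => -[a /= lta] _.
rewrite big1 // => -[b /= ltb] _.
case: (posnP (a + b)) => [/eqP|ab]; last by rewrite IHm ?mulr0 //; lia.
by rewrite addn_eq0 => /andP[/eqP -> /eqP ->]; rewrite F0 mul0r.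
Qed.

Lemma fsubst_finite g F i j : F 0%N 0%N = 0 ->
  finite_set [set m | g m * (F ^+ m) i j != 0].
Proof.
move=> F0; apply: (@finite_set_le _ (i + j)) => m /=; apply: contraR.
by rewrite -ltnNge => lt; rewrite fexp2_small ?mulr0.
Qed.

Lemma psi_finite f p k : f 0%N = 0 ->
  finite_set [set n | ((f ^+ n) k / n`!%:R) *: iter n (derivation p) lX != 0].
Proof.
move=> f0; apply: (@finite_set_le _ k) => m /=; apply: contraR.
by rewrite -ltnNge => lt; rewrite fexp_small ?mul0r ?scale0r.
Qed.

Lemma phi_unit phi : phi 0%N = lX -> phi \is a GRing.unit.
Proof.
move=> phi0; apply/fps_unitP; exists (lmonom 1 (-1)).
by rewrite phi0 [LHS]lmul_shift mul1r addNr.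
Qed.

Lemma fsum_lcoef (I : finType) (G : I -> laurent K) j :
  (\sum_i G i) j = \sum_i G i j.
Proof. by elim/big_rec2: _ => [|i y1 y2 _ <- //]; rewrite lcoef0. Qed.

Lemma lsubst_finite p phi k j : phi 0%N = lX ->
  finite_set [set m | p m * (phi ^ m) k j != 0].
Proof.
move=> phi0.
have [c Hc] : exists c : nat, forall a, (0 < a <= k)%N ->
    forall i, i < 1 - c%:Z -> phi a i = 0.
  elim: k => [|k [c Hc]]; first by exists 0%N => a; lia.
  have [N HN] := lcoefP (phi k.+1); exists (c + `|N|).+1 => a ha i lti.
  have [eak|neak] := eqVneq a k.+1; first by rewrite eak HN //; lia.
  by apply: (Hc a); lia.
have Hpow (m a : nat) (i : int) : (a <= k)%N -> i < m%:Z - (c * a)%N%:Z ->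
    (phi ^+ m) a i = 0.
  elim: m a i => [|m IHm] a i leak lti.
    case: a leak lti => [|a] leak lti; last by rewrite expr0; apply: lcoef0.
    by rewrite expr0 [LHS]lmonomE; case: eqP => //; lia.
  rewrite exprS fcoefM fsum_lcoef big1 // => -[b /= ltb] _.
  apply: (@lmul_coef_small _ _ _ (1 - (c * b)%N%:Z) (m%:Z - (c * (a - b))%N%:Z)).
  - move=> u ltu; case: b ltb ltu => [|b] ltb ltu.
      by rewrite phi0 lmonomE; case: eqP => //; lia.
    by apply: (Hc b.+1); nia.
  - by move=> u; apply: IHm; lia.
  - have : (c * b + c * (a - b) = c * a)%N by rewrite -mulnDr subnKC.
    by lia.
have [N HN] := lcoefP p.
pose B := `|(j + (c * k)%N%:Z)%R|%N.
apply: (@sub_finite_set _ _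
  [set` [seq N + a%:Z | a <- iota 0 (`|N| + B).+1]]); last exact: finite_seq.
move=> m /= nz; change (m \in [seq N + a%:Z | a <- iota 0 (`|N| + B).+1]).
apply/mapP; exists `|m - N|%N.
  rewrite mem_iota; apply/andP; split=> //; rewrite ltnNge; apply/negP => big.
  case: (ltP m N) => [/HN e|leNm]; first by rewrite e mul0r eqxx in nz.
  have [M eM] : exists M : nat, m = M%:Z by exists `|m|%N; lia.
  by move: nz; rewrite eM Hpow ?mulr0 ?eqxx //; lia.
case: (ltP m N) => [/HN e|leNm]; first by rewrite e mul0r eqxx in nz.
by lia.
Qed.

End FormalGroup.

(* Main.v *)
Require Import Defs.
From mathcomp Require Import all_boot all_order all_algebra.
From mathcomp Require Import reals complex.
From mathcomp Require Import classical_sets fsbigop.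
From mathcomp Require Import zify ring.

(* Let D = p(x) d/dx. As D is a derivation, E g = e^(f(z) D) g is a ring morphism
   K((x)) -> K((x))[[z]]; it agrees with the substitution g |-> g(psi) at g = x,
   hence on all powers of x, hence everywhere by continuity. So psi(psi(x,y),z)
   is \sum_(a, b) f(y)^a f(z)^b / (a! b!) D^(a+b) x, and by the binomial theorem
   so is psi(x,F(y,z)), because f(F(y,z)) = f(y) + f(z). Conversely, the part of
   the associate equation linear in z recursively determines phi from its
   coefficient p(x) of z, and psi_p has that same coefficient. *)

Set Implicit Arguments.
Unset Strict Implicit.
Unset Printing Implicit Defensive.

Import Order.TTheory GRing.Theory Num.Theory.
Local Open Scope ring_scope.

(** * Finite-support sums as finite sums, and summation over a triangle *)

Lemma fsum_ord (V : nmodType) (G : nat -> V) N :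
  (forall m, (N <= m)%N -> G m = 0) ->
  \sum_(m \in [set: nat]) G m = \sum_(m < N) G m.
Proof.
move=> G0; rewrite -(@fsbig_widen _ _ 0 +%R [set` index_iota 0 N]) //.
  by rewrite -fsbig_seq ?iota_uniq // big_mkord.
move=> m /= [_ mN]; apply: G0; rewrite leqNgt; apply/negP => lt.
by apply: mN; rewrite mem_index_iota.
Qed.

Lemma sum_ord_widen (V : nmodType) (G : nat -> V) M N :
  (forall m, (M <= m)%N -> G m = 0) -> (M <= N)%N ->
  \sum_(m < N) G m = \sum_(m < M) G m.
Proof.
move=> G0 leMN; rewrite -(subnKC leMN) big_split_ord /= [X in _ + X]big1 ?addr0 //.
by move=> i _; apply: G0; rewrite leq_addr.
Qed.

(** Grouping by [n = i + j] covers the triangle [i + j <= N]; as [H] vanishes beyond it, the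
    triangle can be completed to a square. *)
Lemma sum_triangle (V : nmodType) N (H : nat -> nat -> V) :
  (forall i j, (N < i + j)%N -> H i j = 0) ->
  \sum_(n < N.+1) \sum_(i < n.+1) H i (n - i)%N =
  \sum_(i < N.+1) \sum_(j < N.+1) H i j.
Proof.
move=> H0.
transitivity (\sum_(n < N.+1) \sum_(i < N.+1 | (i <= n)%N) H i (n - i)%N).
  apply: eq_bigr => n _.
  by rewrite (big_ord_widen N.+1 (fun i => H i (n - i)%N)) ?ltn_ord.
rewrite (exchange_big_dep xpredT) //=; apply: eq_bigr => i _.
have leiN : (i <= N.+1)%N by apply: ltnW.
rewrite -(@big_mkord _ 0 +%R N.+1 (fun n => (i <= n)%N) (fun n => H i (n - i)%N)).
rewrite (@big_cat_nat _ _ _ i) //= big_nat_cond big1 ?add0r; last by move=> n; lia.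
rewrite -[X in \sum_(X <= _ < _ | _) _](add0n i) big_addn.
rewrite (eq_bigl xpredT) => [|n]; last by lia.
rewrite big_mkord (@sum_ord_widen _ (H i) (N.+1 - i) N.+1); last lia.
  by apply: eq_bigr => n _; rewrite addnK.
by move=> m le; apply: H0; lia.
Qed.

(** * Coefficients and congruences of power series *)

Section SeriesRing.
Variable A : comNzRingType.
Implicit Types f g : fps A.

Lemma fcoefD f g n : (f + g) n = f n + g n. Proof. by []. Qed.

Lemma fcoefMn f m n : (f *+ m) n = f n *+ m.
Proof. by elim: m => // m IHm; rewrite !mulrSr fcoefD IHm. Qed.

Lemma fcoefCM (a : A) f n : (fC a * f) n = a * f n.
Proof.
rewrite fcoefM big_ord_recl /= subn0 big1 ?addr0 // => i _.
by rewrite mul0r.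
Qed.

Lemma fCM (a b : A) : fC (a * b) = fC a * fC b.
Proof. by apply/fpsP => n; rewrite fcoefCM /=; case: eqP; rewrite ?mulr0. Qed.

Lemma fCX (a : A) m : fC (a ^+ m) = fC a ^+ m.
Proof. by elim: m => // m IHm; rewrite !exprS fCM IHm. Qed.

(** Congruence modulo [t^(k+1)]. *)
Definition agree k f g := forall i, (i <= k)%N -> f i = g i.

Lemma agreeM k f f' g g' :
  agree k f f' -> agree k g g' -> agree k (f * g) (f' * g').
Proof.
move=> ff gg i leik; rewrite !fcoefM; apply: eq_bigr => -[a /= lta] _.
by rewrite ff ?gg //; lia.
Qed.

Lemma agreeX k f g m : agree k f g -> agree k (f ^+ m) (g ^+ m).
Proof. by move=> fg; elim: m => // m IHm; rewrite !exprS; apply: agreeM. Qed.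

(** Write [f^-1 = (f^-1 * g) * g^-1], where [f^-1 * g] is congruent to [f^-1 * f = 1]. *)
Lemma agreeV k f g : f \is a GRing.unit -> g \is a GRing.unit ->
  agree k f g -> agree k f^-1 g^-1.
Proof.
move=> uf ug fg.
have fVg1 : agree k 1 (f^-1 * g) by rewrite -(mulVr uf); apply: agreeM.
move=> i leik; rewrite -[f^-1](mulrK ug) -[g^-1 in RHS]mul1r.
by symmetry; apply: agreeM leik.
Qed.

Lemma agreeXz k f g (m : int) : f \is a GRing.unit -> g \is a GRing.unit ->
  agree k f g -> agree k (f ^ m) (g ^ m).
Proof.
move=> uf ug fg; case: m => m; first exact: agreeX.
by apply: agreeV; rewrite ?unitrX //; apply: agreeX.
Qed.

End SeriesRing.

(** * Substitution into a two-variable series *)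

Section Substitution.
Variable K : fieldType.
Implicit Types (f g h : fps K) (F G : fps (fps K)).

Lemma fcoef2M F G i j :
  (F * G) i j = \sum_(a < i.+1) \sum_(b < j.+1) F a b * G (i - a)%N (j - b)%N.
Proof. by rewrite fcoefM fcoef_sum. Qed.

Lemma fcoef2CM (a : K) F i j : (fC (fC a) * F) i j = a * F i j.
Proof. by rewrite !fcoefCM. Qed.

Lemma fsubstE g F i j N : F 0%N 0%N = 0 -> (i + j <= N)%N ->
  fsubst g F i j = \sum_(m < N.+1) g m * (F ^+ m) i j.
Proof.
by move=> F0 leN; apply: fsum_ord => m lt; rewrite fexp2_small ?mulr0 //; lia.
Qed.

(** The coefficient of [x^i y^j] only sees powers [F^m] with [m <= i + j], so each substitution can
    be replaced by its polynomial truncation [tr], for which the product expands as a finite double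
    sum. *)
Lemma fsubstM g h F : F 0%N 0%N = 0 ->
  fsubst (g * h) F = fsubst g F * fsubst h F.
Proof.
move=> F0; apply/fpsP => i; apply/fpsP => j; pose N := (i + j)%N.
pose tr g := \sum_(m < N.+1) fC (fC (g m)) * F ^+ m.
have trE g' a b : (a <= i)%N -> (b <= j)%N -> fsubst g' F a b = tr g' a b.
  move=> lea leb; rewrite (@fsubstE _ _ _ _ N) ?leq_add // !fcoef_sum.
  by apply: eq_bigr => m _; rewrite fcoef2CM.
transitivity ((tr g * tr h) i j); last first.
  rewrite !fcoef2M; apply: eq_bigr => -[a /= lta] _.
  by apply: eq_bigr => -[b /= ltb] _; congr (_ * _); symmetry; apply: trE; lia.
rewrite (@fsubstE _ _ _ _ N) // /tr mulr_suml !fcoef_sum.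
transitivity (\sum_(a < N.+1) \sum_(b < N.+1) g a * h b * (F ^+ (a + b)) i j).
  rewrite -(@sum_triangle _ N (fun a b => g a * h b * (F ^+ (a + b)) i j)).
    apply: eq_bigr => n _; rewrite fcoefM mulr_suml.
    by apply: eq_bigr => -[a /= lta] _; rewrite subnKC.
  by move=> a b lt; rewrite fexp2_small ?mulr0.
apply: eq_bigr => a _; rewrite mulr_sumr !fcoef_sum; apply: eq_bigr => b _.
by rewrite mulrACA -exprD -!fCM fcoef2CM.
Qed.

Lemma fsubst1 F : F 0%N 0%N = 0 -> fsubst 1 F = 1.
Proof.
move=> F0; apply/fpsP => i; apply/fpsP => j.
rewrite (@fsubstE _ _ _ _ (i + j)) // big_ord_recl expr0 mul1r big1 ?addr0 //.
by move=> m _; rewrite /= mul0r.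
Qed.

Lemma fsubstX g F m : F 0%N 0%N = 0 -> fsubst (g ^+ m) F = fsubst g F ^+ m.
Proof.
move=> F0; elim: m => [|m IHm]; first exact: fsubst1.
by rewrite !exprS fsubstM // IHm.
Qed.

Lemma in_xM f g : in_x (f * g) = in_x f * in_x g.
Proof.
apply/fpsP => i; rewrite !fcoefM /=; apply/fpsP => j; rewrite fcoef_sum.
under [RHS]eq_bigr do rewrite -fCM.
by rewrite /=; case: eqP => _ //; rewrite big1.
Qed.

Lemma in_xX f m : in_x (f ^+ m) = in_x f ^+ m.
Proof.
elim: m => [|m IHm]; last by rewrite !exprS in_xM IHm.
by apply/fpsP => -[|i]; apply/fpsP => -[|j].
Qed.

Lemma in_xyX f i j k n :
  (in_x f ^+ i * in_y f ^+ j) k n = (f ^+ i) k * (f ^+ j) n.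
Proof. by rewrite -in_xX -fCX mulrC fcoefCM mulrC fcoefCM. Qed.

(** The hypotheses give [F = x + y] plus terms of higher degree, so the part of degree [m] in [F^m]
    is [(x + y)^m]. The induction on [m] is Pascal's rule. *)
Lemma fexp2_lead F i j : F 0%N = fX -> F 1%N 0%N = 1 ->
  (F ^+ (i + j)) i j = 'C(i + j, i)%:R.
Proof.
move=> F0 F10; have F00 : F 0%N 0%N = 0 by rewrite F0.
have F01 : F 0%N 1%N = 1 by rewrite F0.
have [m em] : exists m, (i + j)%N = m by eexists.
rewrite em; elim: m i j em => [|m IHm] i j em.
  by have [-> ->] : i = 0%N /\ j = 0%N by lia.
rewrite exprS fcoef2M.
(* Only the terms [x] and [y] of the first factor contribute: a term of degree above 1 leaves a
   degree below [m] for [F^m]. *)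
have z a b : (1 < a + b)%N -> (a <= i)%N -> (b <= j)%N ->
   F a b * (F ^+ m) (i - a)%N (j - b)%N = 0.
  by move=> lt la lb; rewrite fexp2_small ?mulr0 //; lia.
rewrite big_ord_recl big_ord_recl /= F00 mul0r add0r.
have -> : \sum_(b < j) F 0%N (bump 0 b) * (F ^+ m) (i - 0)%N (j - bump 0 b)%N
    = 'C(m, i)%:R.
  (* For [j = 0] the sum is empty, and [i = m + 1] makes the binomial zero. *)
  case: j em z => [|j] em z.
    by rewrite big_ord0 bin_small //; lia.
  rewrite big_ord_recl big1 => [|[b /= ltb] _]; last by rewrite /bump z //; lia.
  by rewrite /bump F01 mul1r addr0 subn0 subSS subn0 IHm //; lia.
case: i em z => [|i] em z; first by rewrite big_ord0 addr0 !bin0.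
rewrite big_ord_recl [X in _ + (_ + X)]big1 => [|[a /= lta] _]; last first.
  by apply: big1 => -[b /= ltb] _; rewrite /bump z //; lia.
rewrite addr0 big_ord_recl big1 => [|[b /= ltb] _]; last by rewrite /bump z //; lia.
by rewrite /bump F10 mul1r addr0 subSS !subn0 IHm ?binS ?natrD; last lia.
Qed.

End Substitution.

(** * Derivations of Laurent series *)

Section LaurentCalculus.
Variable K : fieldType.
Implicit Types (g h p : laurent K).

Lemma lcoefD g h i : (g + h) i = g i + h i. Proof. by []. Qed.
Lemma lcoefZ a g i : (a *: g) i = a * g i. Proof. by []. Qed.

Lemma lmonomM (a b : int) :
  lmonom 1 a * lmonom 1 b = lmonom 1 (a + b) :> laurent K.
Proof. by rewrite [LHS]lmul_shift mul1r. Qed.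

Definition vanish_below (N : int) g := forall i, i < N -> g i = 0.

Lemma vanish_belowM N M g h :
  vanish_below N g -> vanish_below M h -> vanish_below (N + M) (g * h).
Proof. by move=> gN hM i; apply: lmul_coef_small. Qed.

Lemma lcoefM_shift N M g h (k : nat) :
  vanish_below N g -> vanish_below M h ->
  (g * h) (N + M + k%:Z) = \sum_(a < k.+1) g (N + a%:Z) * h (M + (k - a)%N%:Z).
Proof. exact: lmul_coef_shift. Qed.

Lemma vanish_below_deriv N g : vanish_below N g -> vanish_below (N - 1) (lderiv g).
Proof. by move=> gN i lti /=; rewrite gN ?mul0rz //; lia. Qed.

Lemma lmulZl a g h : (a *: g) * h = a *: (g * h).
Proof.
have [N gN] := lcoefP g; have [M hM] := lcoefP h.
have agN : vanish_below N (a *: g) by move=> i lt; rewrite lcoefZ gN ?mulr0.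
apply/laurentP => n; rewrite lcoefZ; have [lt|le] := ltP n (N + M).
  by rewrite (vanish_belowM agN hM) // (vanish_belowM gN hM) // mulr0.
have -> : n = N + M + `|(n - (N + M))%R|%N%:Z by lia.
rewrite (lcoefM_shift _ agN hM) (lcoefM_shift _ gN hM) // mulr_sumr; apply: eq_bigr => i _.
by rewrite lcoefZ mulrA.
Qed.

Lemma lmulZr a g h : g * (a *: h) = a *: (g * h).
Proof. by rewrite mulrC lmulZl mulrC. Qed.

Lemma lderivM g h : lderiv (g * h) = lderiv g * h + g * lderiv h.
Proof.
have [N gN] := lcoefP g; have [M hM] := lcoefP h.
have g'N := vanish_below_deriv gN; have h'M := vanish_below_deriv hM.
apply/laurentP => n; rewrite lcoefD.
have [lt|le] := ltP n (N + M - 1).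
  rewrite (vanish_below_deriv (vanish_belowM gN hM)) //.
  by rewrite (vanish_belowM g'N hM) ?(vanish_belowM gN h'M) ?addr0 //; lia.
(* The three products have order bounds [N + M], [N - 1 + M] and [N + (M - 1)], so this one [k]
   indexes all three finite sums. Termwise the rule becomes [n + 1 = (N + a) + (M + (k - a))]. *)
pose k := `|(n - (N + M - 1))%R|%N.
have e1 : n + 1 = N + M + k%:Z by rewrite /k; lia.
have e2 : n = (N - 1) + M + k%:Z by rewrite /k; lia.
have e3 : n = N + (M - 1) + k%:Z by rewrite /k; lia.
rewrite [LHS](_ : _ = (g * h) (N + M + k%:Z) *~ (N + M + k%:Z)); last first.
  by rewrite -e1.
rewrite (lcoefM_shift _ gN hM) {1}e2 (lcoefM_shift _ g'N hM).
rewrite e3 (lcoefM_shift _ gN h'M).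
rewrite mulrz_suml -big_split; apply: eq_bigr => -[a /= lta] _.
have -> : N - 1 + a%:Z + 1 = N + a%:Z by lia.
have -> : M - 1 + (k - a)%N%:Z + 1 = M + (k - a)%N%:Z by lia.
by rewrite mulrzAl mulrzAr -mulrzDr; congr (_ *~ _); lia.
Qed.

Variable p : laurent K.
Local Notation D := (derivation p).

Lemma derivationD g h : D (g + h) = D g + D h.
Proof.
rewrite /derivation -mulrDr; congr (_ * _).
by apply/laurentP => i /=; rewrite mulrzDl.
Qed.

Lemma derivationZ a g : D (a *: g) = a *: D g.
Proof.
rewrite /derivation -lmulZr; congr (_ * _).
by apply/laurentP => i /=; rewrite mulrzAr.
Qed.

Lemma derivationM g h : D (g * h) = D g * h + g * D h.
Proof. by rewrite /derivation lderivM mulrDr mulrA; congr (_ + _); rewrite mulrCA. Qed.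

Lemma derivation1 : D 1 = 0.
Proof.
rewrite /derivation (_ : lderiv 1 = 0) ?mulr0 //; apply/laurentP => i.
rewrite lcoef0 [LHS](_ : _ = (lmonom 1 0 : laurent K) (i + 1) *~ (i + 1)) //.
by rewrite lmonomE; case: eqP => [->|]; rewrite ?mulr0z ?mul0rz.
Qed.

Lemma derivationX : D lX = p.
Proof.
rewrite /derivation (_ : lderiv lX = 1) ?mulr1 //; apply/laurentP => i.
rewrite [LHS](_ : _ = (lmonom 1 1 : laurent K) (i + 1) *~ (i + 1)) //.
rewrite [RHS](_ : _ = (lmonom 1 0 : laurent K) i) // !lmonomE.
have [->|i0] := eqVneq i 0; first by [].
by case: eqP => [|_]; [lia | rewrite mul0rz].
Qed.

Lemma iter_derivation_linear n a g h :
  iter n D (a *: g + h) = a *: iter n D g + iter n D h.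
Proof. by elim: n => //= n ->; rewrite derivationD derivationZ. Qed.

Lemma iter_derivation_sum n I (r : seq I) (c : I -> K) (G : I -> laurent K) :
  iter n D (\sum_(i <- r) c i *: G i) = \sum_(i <- r) c i *: iter n D (G i).
Proof.
have D0 : iter n D 0 = 0.
  by elim: n => //= n ->; rewrite -[0 in LHS](scale0r 0) derivationZ scale0r.
elim: r => [|i r IHr]; first by rewrite !big_nil.
by rewrite !big_cons iter_derivation_linear IHr.
Qed.

(** The iterated Leibniz rule, by induction with Pascal's rule. *)
Lemma iter_derivationM n g h :
  iter n D (g * h) =
  \sum_(i < n.+1) 'C(n, i)%:R *: (iter i D g * iter (n - i) D h).
Proof.
elim: n => [|n IHn]; first by rewrite big_ord1 scale1r.
rewrite iterS IHn -[D _]/(iter 1 D _) iter_derivation_sum /=.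
pose t m i : laurent K := 'C(m, i)%:R *: (iter i D g * iter (n.+1 - i) D h).
transitivity (\sum_(i < n.+1) t n i + \sum_(i < n.+1)
    'C(n, i)%:R *: (iter i.+1 D g * iter (n - i) D h)).
  rewrite -big_split; apply: eq_bigr => -[i /= lti] _.
  by rewrite derivationM scalerDr addrC /t subSn.
(* The added term is zero since ['C(n, n + 1) = 0]; it aligns the two sums for Pascal's rule. *)
have -> : \sum_(i < n.+1) t n i = \sum_(i < n.+2) t n i.
  by rewrite [RHS]big_ord_recr /= {3}/t bin_small // scale0r addr0.
rewrite -[RHS]/(\sum_(i < n.+2) t n.+1 i).
rewrite [RHS]big_ord_recl [X in X + _]big_ord_recl -addrA.
rewrite -big_split; congr (_ + _); first by rewrite /t !bin0.
apply: eq_bigr => -[i /= lti] _.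
by rewrite /t /bump /= add1n subSS -scalerDl -natrD binS.
Qed.

(** Continuity of the iterates of [D], with a bound [M] uniform in [n <= N]. This is what reduces
    identities for [flow] to monomials. *)
Lemma iter_derivation_continuous N (j : int) :
  exists M : int, forall n g, (n <= N)%N -> vanish_below M g -> iter n D g j = 0.
Proof.
have [c pc] : exists c : nat, vanish_below (1 - c%:Z) p.
  have [N0 pN0] := lcoefP p; exists `|(1 - N0)%R|%N => i lti.
  by apply: pN0; lia.
(* Each [D] lowers the order by at most [c]: [1 - c] comes from [p] and [-1] from the derivative.
   After [N] of them the order is still above [j]. *)
exists (j + 1 + (N * c)%N%:Z) => n g leN gM.
have : forall m, vanish_below (j + 1 + (N * c)%N%:Z - (m * c)%N%:Z) (iter m D g).
  elim=> [|m IHm]; first by move=> i lti; apply: gM; lia.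
  move=> i lti /=; apply: (vanish_belowM pc (vanish_below_deriv IHm)).
  by rewrite mulSn in lti; lia.
by move/(_ n); apply; have := leq_mul leN (leqnn c); lia.
Qed.

End LaurentCalculus.

(** * Continuous linear functionals on Laurent series *)

Section ContinuousFunctional.
Variable K : fieldType.

(** Subtracting from [g] its finitely many terms below [x^M] leaves a series killed by [L]; on the
    subtracted part linearity suffices. *)
Lemma continuous_functionalE (L : laurent K -> K) (M : int) (g : laurent K) :
  (forall a g h, L (a *: g + h) = a * L g + L h) ->
  (forall h, vanish_below M h -> L h = 0) ->
  L g = \sum_(m \in [set: int]) g m * L (lmonom 1 m).
Proof.
move=> Llin LM; have [N gN] := lcoefP g.
(* These exponents include all those from [N] to [M - 1]; the extra ones that occur when [M < N] are
   harmless. *)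
pose s := [seq N + a%:Z | a <- iota 0 `|(M - N)%R|%N].
have memsP m : N <= m < M -> m \in s.
  by move=> ltm; apply/mapP; exists `|(m - N)%R|%N; rewrite ?mem_iota; lia.
have us : uniq s by rewrite map_inj_uniq ?iota_uniq // => a b; lia.
have L0 : L 0 = 0 by apply: LM => i _; apply: lcoef0.
have Lsum (r : seq int) h :
    L (\sum_(m <- r) g m *: lmonom 1 m + h) = \sum_(m <- r) g m * L (lmonom 1 m) + L h.
  elim: r => [|m r IHr]; first by rewrite !big_nil !add0r.
  by rewrite !big_cons -!addrA Llin IHr.
rewrite -(@fsbig_widen _ _ 0 +%R [set` s]) //; last first.
  move=> m /= [_ ms]; have [lt|le] := ltP m N; first by rewrite gN // mul0r.
  have [lt|leM] := ltP m M; first by case: ms; apply: memsP; rewrite le.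
  rewrite LM ?mulr0 // => i lti; rewrite lmonomE; case: eqP => // ei; lia.
rewrite -fsbig_seq //.
rewrite -[LHS](congr1 L (subrKC (\sum_(m <- s) g m *: lmonom 1 m) g)).
rewrite Lsum LM ?addr0 // => i lti.
have sumE (r : seq int) : uniq r ->
    (\sum_(m <- r) g m *: lmonom 1 m) i = if i \in r then g i else 0.
  elim: r => [|m r IHr]; first by rewrite big_nil lcoef0.
  rewrite big_cons cons_uniq => /andP[mr ur].
  rewrite lcoefD lcoefZ lmonomE IHr // in_cons; case: eqVneq => [->|_] /=.
    by rewrite (negPf mr) mulr1 addr0.
  by rewrite mulr0 add0r.
rewrite lcoefD [(- _ : laurent K) i](_ : _ = - (\sum_(m <- s) g m *: lmonom 1 m) i) //.
rewrite sumE //; case: ifP => [_|/negP si]; first by rewrite subrr.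
rewrite subr0; apply: gN; rewrite ltNge; apply/negP => le; apply: si.
by apply: memsP; rewrite le.
Qed.

End ContinuousFunctional.

(** * The exponential flow of [D], and [psi] as an associate *)

Section Flow.
Variables (K : numFieldType) (f : fps K) (p : laurent K).
Hypothesis f0 : f 0%N = 0.
Implicit Types g h : laurent K.
Local Notation D := (derivation p).

(* e^(f(z) D) g *)
Definition flow g : fps (laurent K) :=
  Fps (fun k => \sum_(n < k.+1) ((f ^+ n) k / n`!%:R) *: iter n D g).

(** As [f] has no constant term, [f^n] starts at [z^n]; a common cutoff [N] can thus serve several
    coefficients at once. *)
Lemma flowE N k g : (k <= N)%N ->
  flow g k = \sum_(n < N.+1) ((f ^+ n) k / n`!%:R) *: iter n D g.
Proof.
move=> leN.
rewrite (@sum_ord_widen _ (fun n => ((f ^+ n) k / n`!%:R) *: iter n D g) k.+1) //.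
by move=> m lt; rewrite fexp_small // mul0r scale0r.
Qed.

Lemma flow_linear a g h k : flow (a *: g + h) k = a *: flow g k + flow h k.
Proof.
rewrite /= scaler_sumr -big_split; apply: eq_bigr => n _ /=.
by rewrite iter_derivation_linear scalerDr !scalerA [_ * a]mulrC.
Qed.

Lemma flow_at0 g : flow g 0%N = g.
Proof. by rewrite /= big_ord1 divr1 scale1r. Qed.

Lemma flow1 : flow 1 = 1.
Proof.
apply/fpsP => -[|k]; first exact: flow_at0.
rewrite /= big1 // => -[[|n] /= ltn] _; first by rewrite mul0r scale0r.
have -> : D (iter n D 1) = 0.
  elim: n {ltn} => [|n /= ->]; first exact: derivation1.
  by rewrite -[0 in LHS](scale0r 0) derivationZ scale0r.
by rewrite scaler0.
Qed.

(** The exponential of a derivation is multiplicative: in the Leibniz rule ['C(n, i) / n!] equals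
    [1 / (i! (n - i)!)], and [f^(i+j)] splits as [f^i * f^j]. *)
Lemma flowM g h : flow (g * h) = flow g * flow h.
Proof.
apply/fpsP => k; rewrite fcoefM.
pose H i j : laurent K :=
  ((f ^+ (i + j)) k / (i`!%:R * j`!%:R)) *: (iter i D g * iter j D h).
transitivity (\sum_(n < k.+1) \sum_(i < n.+1) H i (n - i)%N).
  apply: eq_bigr => n _; rewrite iter_derivationM scaler_sumr.
  apply: eq_bigr => -[i /= lti] _; rewrite scalerA /H subnKC //.
  congr (_ *: _); rewrite -mulrA; congr (_ * _).
  rewrite -(@bin_fact n i) // !natrM.
  have nz m : m`!%:R != 0 :> K by rewrite pnatr_eq0 -lt0n fact_gt0.
  by field; rewrite !nz /= pnatr_eq0 -lt0n bin_gt0.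
rewrite sum_triangle; last first.
  by move=> i j lt; rewrite /H fexp_small // mul0r scale0r.
transitivity (\sum_(a < k.+1) \sum_(i < k.+1) \sum_(j < k.+1)
   (((f ^+ i) a * (f ^+ j) (k - a)%N) / (i`!%:R * j`!%:R))
     *: (iter i D g * iter j D h)).
  rewrite [RHS]exchange_big; apply: eq_bigr => i _.
  rewrite [RHS]exchange_big; apply: eq_bigr => j _.
  by rewrite -scaler_suml /H exprD fcoefM mulr_suml.
apply: eq_bigr => -[a /= lta] _.
rewrite -[RHS]/(flow g a * flow h (k - a)%N) (@flowE k a) //.
rewrite (@flowE k (k - a)) ?leq_subr //.
rewrite mulr_suml; apply: eq_bigr => i _; rewrite mulr_sumr; apply: eq_bigr => j _.
by rewrite lmulZl lmulZr scalerA invfM mulrACA.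
Qed.

Lemma flow_lX : flow lX = psi f p.
Proof.
apply/fpsP => k; rewrite [RHS](@fsum_ord _ _ k.+1) // => m lt.
by rewrite fexp_small // mul0r scale0r.
Qed.

Lemma psi_at0 : psi f p 0%N = lX.
Proof. by rewrite -flow_lX flow_at0. Qed.

(** Multiplicativity gives the nonnegative powers, and then the negative ones as inverses. *)
Lemma flow_lmonom (m : int) : flow (lmonom 1 m) = psi f p ^ m.
Proof.
have flowX (n : nat) : flow (lmonom 1 n%:Z) = psi f p ^+ n.
  elim: n => [|n IHn]; first exact: flow1.
  by rewrite exprS -IHn -flow_lX -flowM lmonomM; congr (flow (lmonom 1 _)); lia.
case: m => n; first exact: flowX.
have u : psi f p ^+ n.+1 \is a GRing.unit by rewrite unitrX // phi_unit // psi_at0.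
apply: (mulIr u); rewrite mulVr // -flowX -flowM lmonomM NegzE addNr.
exact: flow1.
Qed.

(* Both sides are continuous in [g], and they agree on the powers of [x] because
   [flow] is multiplicative. *)
Lemma lsubst_psi g k j : lsubst_coef g (psi f p) k j = flow g k j.
Proof.
have [M DM] := iter_derivation_continuous p k j.
rewrite (@continuous_functionalE _ (fun h => flow h k j) M).
- by apply: eq_fsbigr => m _; rewrite flow_lmonom.
- by move=> a h h'; rewrite flow_linear lcoefD lcoefZ.
- move=> h hM; rewrite fsum_lcoef big1 // => -[n /= ltn] _.
  by rewrite DM // mulr0.
Qed.

Lemma psi_associate (F : fps (fps K)) : F 0%N 0%N = 0 -> fsubst f F = in_x f + in_y f ->
  associate F (psi f p).
Proof.
move=> F0 fF; split=> [|n k j]; first exact: psi_at0.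
rewrite /iterate_coef lsubst_psi /compose_coef.
pose N := (k + n)%N; pose d m : K := iter m D lX j.
(* The coefficient of [x^j y^k z^n] in [f(y)^a f(z)^b D^(a+b) x / (a! b!)]; both sides are reduced
   to the sum of these. *)
pose c a b : K := (f ^+ a) k * (f ^+ b) n * d (a + b)%N / (a`!%:R * b`!%:R).
transitivity (\sum_(a < N.+1) \sum_(b < N.+1) c a b).
  rewrite (@flowE N) ?leq_addr // fsum_lcoef; apply: eq_bigr => a _.
  rewrite lcoefZ -flow_lX (@flowE N n) ?leq_addl // iter_derivation_sum fsum_lcoef.
  rewrite mulr_sumr; apply: eq_bigr => b _.
  by rewrite lcoefZ -iterD /c /d invfM; ring.
rewrite -sum_triangle; last first.
  move=> a b lt; rewrite /c; case: (ltnP k a) => [lta|lea].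
    by rewrite fexp_small // !mul0r.
  by rewrite [(f ^+ b) n]fexp_small ?mulr0 ?mul0r //; move: lt; rewrite /N; lia.
rewrite (@fsubstE _ _ _ _ _ N) //.
(* Summing over [m] first turns the powers of [F] into [f(F(y,z))^i = (f(y) + f(z))^i], to which the
   binomial theorem applies. *)
transitivity (\sum_(m < N.+1) \sum_(i < N.+1)
    (d i / i`!%:R) * ((f ^+ i) m * (F ^+ m) k n)).
  rewrite exchange_big; apply: eq_bigr => -[i /= lti] _.
  rewrite -mulr_sumr -fsubstE // fsubstX // fF addrC exprDn !fcoef_sum mulr_sumr.
  apply: eq_bigr => -[a /= lta] _.
  rewrite !fcoefMn [in_y f ^+ _ * _]mulrC in_xyX /c subnKC //.
  have nz m : m`!%:R != 0 :> K by rewrite pnatr_eq0 -lt0n fact_gt0.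
  rewrite -mulr_natr -(@bin_fact i a) // !natrM.
  by field; rewrite !nz /= pnatr_eq0 -lt0n bin_gt0.
apply: eq_bigr => -[m /= ltm] _; rewrite -[X in _ = X * _]/(psi f p m j) -flow_lX.
rewrite (@flowE N) // fsum_lcoef mulr_suml.
by apply: eq_bigr => i _; rewrite lcoefZ /d; ring.
Qed.

Lemma psi_at1 : f 1%N = 1 -> psi f p 1%N = p.
Proof.
move=> f1; rewrite -flow_lX /= big_ord_recl big_ord1 /= mul0r scale0r add0r.
by rewrite expr1 f1 divr1 scale1r derivationX.
Qed.

End Flow.

(** * An associate is determined by its coefficient of [z] *)

Section Uniqueness.
Variable K : numFieldType.

(** Powers [F^m] with [m > k + 1] have no term [y^k z], and in [F^(k+1)] its coefficient is
    ['C(k + 1, k) = k + 1]. *)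
Lemma compose_coef1E (F : fps (fps K)) (phi : fps (laurent K)) k j :
  F 0%N = fX -> F 1%N 0%N = 1 ->
  compose_coef phi F 1 k j =
  \sum_(m < k.+1) phi m j * (F ^+ m) k 1%N + phi k.+1 j * k.+1%:R.
Proof.
move=> F0 F10; have F00 : F 0%N 0%N = 0 by rewrite F0.
have lead : (F ^+ k.+1) k 1%N = k.+1%:R.
  by rewrite -[in F ^+ _]addn1 fexp2_lead // addn1 binSn.
rewrite /compose_coef (@fsubstE _ _ _ _ _ k.+1) ?addn1 //.
by rewrite big_ord_recr -lead.
Qed.

(* The coefficient of [z] in the associate equation reads
   phi_1(phi(x,y)) = \sum_m phi_m(x) m y^(m-1) (1 + ...), so its coefficient of
   [y^k] expresses (k+1) phi_(k+1) in terms of phi_0, ..., phi_k. *)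
Lemma associate_unique (F : fps (fps K)) (phi phi' : fps (laurent K)) :
  F 0%N = fX -> F 1%N 0%N = 1 -> associate F phi -> associate F phi' ->
  phi 1%N = phi' 1%N -> phi = phi'.
Proof.
move=> F0 F10 [phi0 phiF] [phi'0 phi'F] phi1.
have F00 : F 0%N 0%N = 0 by rewrite F0.
suff H k : agree k phi phi' by apply/fpsP => k; apply: (H k).
elim: k => [|k IHk] i; first by rewrite leqn0 => /eqP ->; rewrite phi0.
rewrite leq_eqVlt => /predU1P[->{i}|]; last exact: IHk.
apply/laurentP => j.
have: compose_coef phi F 1 k j = compose_coef phi' F 1 k j.
  rewrite -phiF -phi'F /iterate_coef phi1; apply: eq_fsbigr => m _.
  (* Modulo [y^(k+1)], every power of [phi], negative ones included, depends only on [phi] modulo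
     [y^(k+1)], because [phi] is a unit. *)
  apply: (congr1 (fun u : laurent K => phi' 1%N m * u j)).
  exact: (agreeXz m (phi_unit phi0) (phi_unit phi'0) IHk (leqnn k)).
rewrite !compose_coef1E //.
rewrite (eq_bigr (fun m : 'I_k.+1 => phi' m j * (F ^+ m) k 1%N)); last first.
  by move=> [m /= ltm] _; rewrite IHk.
(* The factor [k + 1] cancels in characteristic zero. *)
by move/addrI/mulIf; apply; rewrite pnatr_eq0.
Qed.

End Uniqueness.

Theorem theorem2p12 (R : realType) (F : fps (fps (complex R)))
    (f : fps (complex R)) (hF : formal_group F) (hf : is_log F f) :
  (forall p : laurent (complex R), associate F (psi f p)) /\
  (forall phi : fps (laurent (complex R)), associate F phi ->
     exists p : laurent (complex R), phi = psi f p).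
Proof.
have [/fpsP/(_ 1%N) /= F10 F0 _] := hF; have [f0 f1 fF] := hf.
have psiF p : associate F (psi f p) by apply: psi_associate => //; rewrite F0.
(* The witness is the coefficient of [z] in [phi]; since [f'(0) = 1], [psi f p] has [p] as its
   coefficient of [z]. *)
split=> // phi phiF; exists (phi 1%N).
by apply: (associate_unique F0) => //; rewrite psi_at1.
Qed.
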